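(* Let $A\in\mathbb R^{n\times n}$ be symmetric positive definite, and let $\mathcal C=\{U_\alpha\}_{\alpha\in I}$ ($I$ a finite index set) be a cover of the index set $\{1,\dots,n\}$, i.e. $U_\alpha\subseteq\{1,\dots,n\}$ for each $\alpha\in I$ and $\bigcup_{\alpha\in I}U_\alpha=\{1,\dots,n\}$. For each $\alpha\in I$ let $R_\alpha:\mathbb R^n\to\mathbb R^{|U_\alpha|}$ be the Boolean restriction to the coordinates in $U_\alpha$. Then the following are equivalent: (1) there exist symmetric positive semidefinite matrices $\widetilde A_\alpha\in\mathbb R^{|U_\alpha|\times|U_\alpha|}$, $\alpha\in I$, such that $$A=\sum_{\alpha\in I}R_\alpha^\top\widetilde A_\alpha R_\alpha;$$ (2) there exist $m\in\mathbb N$ and a $\mathcal C$-local matrix $G\in\mathbb R^{m\times n}$ such that $A=G^\top G$.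
   Context: For $X\subseteq\{1,\dots,n\}$, the Boolean restriction to $X$ is the matrix $I_n(X,:)\in\mathbb R^{|X|\times n}$ formed by the rows of the $n\times n$ identity indexed by $X$; $R_\alpha$ is the Boolean restriction to $U_\alpha$. For a matrix $G\in\mathbb R^{m\times n}$, write its rows as $\bm g_1^\top,\dots,\bm g_m^\top$ with $\bm g_j\in\mathbb R^n$, and set $\operatorname{supp}(\bm g_j)=\{k:(\bm g_j)_k\neq0\}$. The matrix $G$ is called $\mathcal C$-local if for every $j\in\{1,\dots,m\}$ there exists $\alpha(j)\in I$ with $\operatorname{supp}(\bm g_j)\subseteq U_{\alpha(j)}$. *)

(* Defs.v *)
From mathcomp Require Import all_boot all_order all_algebra.
From mathcomp Require Import reals.

Set Implicit Arguments.
Unset Strict Implicit.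
Unset Printing Implicit Defensive.

Import Order.TTheory GRing.Theory Num.Theory.

Local Open Scope ring_scope.

Definition sym_posdef (R : realType) (n : nat) (A : 'M[R]_n) : Prop :=
  A \is symmetricmx /\
  forall x : 'cV[R]_n, x != 0 -> 0 < (x^T *m A *m x) 0 0.

Definition sym_possemidef (R : realType) (n : nat) (A : 'M[R]_n) : Prop :=
  A \is symmetricmx /\
  forall x : 'cV[R]_n, 0 <= (x^T *m A *m x) 0 0.

(* Families are indexed: repeated and empty sets [U a] are allowed. *)
Definition index_cover (n : nat) (I : finType) (U : I -> {set 'I_n}) : Prop :=
  \bigcup_(a : I) U a = [set: 'I_n].

(* [enum_val] lists the elements of [X] in increasing order, so this is the
   matrix I_n(X,:) of the rows of the identity indexed by [X]. *)
Definition bool_restriction (R : realType) (n : nat) (X : {set 'I_n})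
    : 'M[R]_(#|X|, n) :=
  rowsub (fun i : 'I_#|X| => enum_val i) 1%:M.

Definition supp (R : realType) (n : nat) (g : 'cV[R]_n) : {set 'I_n} :=
  [set k | g k 0 != 0].

Definition cover_local (R : realType) (n : nat) (I : finType)
    (U : I -> {set 'I_n}) (m : nat) (G : 'M[R]_(m, n)) : Prop :=
  forall j : 'I_m, exists a : I, supp (row j G)^T \subset U a.

(* Main.v *)
(** A positive semidefinite matrix is a Gram matrix [B^T B] (Cholesky, peeling
    off one row and column at a time through the Schur complement), so each
    local term is the Gram matrix of [B R_a], whose rows are supported in [U_a],
    and sums of Gram matrices are obtained by stacking the factors. Conversely
    [G^T G] is the sum of the rank-one matrices [g_j g_j^T]; grouping the indices
    [j] by the set [U_a] that contains [supp g_j] gives the local matrices. *)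

Require Import Defs.
From mathcomp Require Import all_boot all_order all_algebra.
From mathcomp Require Import reals.
From mathcomp Require Import ring lra.

Set Implicit Arguments.
Unset Strict Implicit.
Unset Printing Implicit Defensive.

Import Order.TTheory GRing.Theory Num.Theory.

Local Open Scope ring_scope.

Lemma symmetricmxP (R : fieldType) (n : nat) (A : 'M[R]_n) :
  reflect (A^T = A) (A \is symmetricmx).
Proof.
by apply: (iffP (is_hermitianmxP _ _ _)); rewrite expr0 scale1r map_mx_id.
Qed.

Section Gram.
Variable R : realType.

Lemma quad_gram m n (B : 'M[R]_(m, n)) (x : 'cV[R]_n) :
  (x^T *m (B^T *m B) *m x) 0 0 = \sum_i (B *m x) i 0 ^+ 2.
Proof.
rewrite mulmxA -trmx_mul -mulmxA mxE.
by apply: eq_bigr => i _; rewrite mxE expr2.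
Qed.

Lemma gram_possemidef m n (B : 'M[R]_(m, n)) : sym_possemidef (B^T *m B).
Proof.
split=> [|x]; first by apply/symmetricmxP; rewrite trmx_mul trmxK.
by rewrite quad_gram; apply: sumr_ge0 => i _; apply: sqr_ge0.
Qed.

(** For fixed [x] this is a quadratic polynomial in the scalar [y]; the lemmas below get their
    information from a well-chosen [y]. *)
Lemma quad_block n (a y : R) (u : 'rV[R]_n) (C : 'M[R]_n) (x : 'cV[R]_n) :
  ((col_mx y%:M x)^T *m block_mx a%:M u u^T C *m col_mx y%:M x) 0 0 =
  a * y ^+ 2 + 2 * y * (u *m x) 0 0 + (x^T *m C *m x) 0 0.
Proof.
rewrite tr_col_mx mul_row_block mul_row_col tr_scalar_mx.
rewrite !mulmxDl -[x^T *m u^T]trmx_mul -[_ *m u *m x]mulmxA.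
rewrite [u *m x]mx11_scalar !tr_scalar_mx -!scalar_mxM.
rewrite !mxE /= ?mulr1n; ring.
Qed.

(** With a zero corner the form at [(y, e_k)] is affine in [y], with slope twice the [k]-th entry of
    [u]. A nonzero slope would make it take negative values. *)
Lemma possemidef_offdiag0 n (u : 'rV[R]_n) (C : 'M[R]_n) :
  sym_possemidef (block_mx (0 : R)%:M u u^T C : 'M_(1 + n)) -> u = 0.
Proof.
move=> [_ Ppos]; apply/rowP => k; rewrite mxE.
have -> : u 0 k = (u *m delta_mx k (0 : 'I_1)) 0 0 by rewrite -colE mxE.
set x := delta_mx _ _; set b := (u *m x) 0 0; set c := (x^T *m C *m x) 0 0.
apply/eqP/negPn/negP => b0.
(* The first coordinate is the solution [y] of [2 * y * b + c = -1]. *)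
have := Ppos (col_mx (- (c + 1) / (2 * b))%:M x).
rewrite quad_block -/b -/c.
have -> : 0 * (- (c + 1) / (2 * b)) ^+ 2 + 2 * (- (c + 1) / (2 * b)) * b + c
  = -1 by field.
by rewrite lerNr oppr0 ler10.
Qed.

(* The case [a = 0] is included: there [a^-1 = 0] and the complement is [C]. *)
Lemma possemidef_schur n (a : R) (u : 'rV[R]_n) (C : 'M[R]_n) :
  sym_possemidef (block_mx a%:M u u^T C : 'M_(1 + n)) ->
  sym_possemidef (C - a^-1 *: (u^T *m u)).
Proof.
move=> PA; have [/symmetricmxP symA posA] := PA; split=> [|x].
  move: symA; rewrite tr_block_mx => /eq_block_mx[_ _ _ symC].
  by apply/symmetricmxP; rewrite linearB linearZ /= trmx_mul trmxK symC.
rewrite mulmxBr mulmxBl -scalemxAr -scalemxAl.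
have posx y : 0 <= a * y ^+ 2 + 2 * y * (u *m x) 0 0 + (x^T *m C *m x) 0 0.
  by rewrite -quad_block.
have := quad_gram u x; rewrite big_ord1; move: posx.
move: (_ *m C *m _) (_ *m (u^T *m u) *m _) ((u *m x) 0 0) => M N b posx Nb.
rewrite !mxE Nb; have [a0|a0] := eqVneq a 0.
  by have := posx 0; rewrite a0 invr0; lra.
(* The point [- b / a] is the critical point of the quadratic in [y]; its value there is
   [M 0 0 - b ^+ 2 / a], the form of the Schur complement. *)
by have := posx (- b / a); congr (0 <= _); field.
Qed.

Lemma possemidef_gram n (A : 'M[R]_n) :
  sym_possemidef A -> exists m (B : 'M[R]_(m, n)), A = B^T *m B.
Proof.
elim: n A => [|n IHn] A PA.
  by exists 0%N, 0; apply/matrixP => - [].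
move: A PA; rewrite -[n.+1]/(1 + n)%N => A PA.
have [/symmetricmxP symA _] := PA.
have defA : A = block_mx (ulsubmx A 0 0)%:M (ursubmx A) (ursubmx A)^T (drsubmx A).
  by rewrite -mx11_scalar trmx_ursub symA submxK.
move: (ulsubmx A 0 0) (ursubmx A) (drsubmx A) defA => a u C defA.
rewrite {}defA in PA *.
have [m [B defC]] := IHn _ (possemidef_schur PA).
have a_ge0 : 0 <= a.
  have [_ /(_ (col_mx 1%:M 0))] := PA.
  by rewrite quad_block !mulmx0 !mxE; lra.
have sqK : Num.sqrt a * Num.sqrt a = a by rewrite -expr2 sqr_sqrtr.
(* The delicate case is [a = 0]: the inverse is then 0 by convention and the left side vanishes, but
   semidefiniteness forces [u = 0] as well. *)
have sqVu : Num.sqrt a *: ((Num.sqrt a)^-1 *: u) = u.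
  have [a0|a0] := eqVneq a 0.
    by rewrite a0 in PA; rewrite (possemidef_offdiag0 PA) !scaler0.
  by rewrite scalerA divff ?scale1r // sqrtr_eq0 -ltNge lt_def a0.
(* One Cholesky step: the Gram matrix of the new top row has blocks [a], [u], [u^T] and
   [a^-1 *: (u^T *m u)]. The last one restores what the Schur complement took from [C], and [B]
   accounts for the rest. *)
exists (1 + m)%N.
exists (col_mx (row_mx (Num.sqrt a)%:M ((Num.sqrt a)^-1 *: u)) (row_mx 0 B)).
rewrite tr_col_mx mul_row_col !tr_row_mx !mul_col_row add_block_mx.
rewrite !trmx0 !mulmx0 !mul0mx !addr0 tr_scalar_mx.
rewrite !mul_scalar_mx mul_mx_scalar scale_scalar_mx sqK.
rewrite sqVu -[_ *: _^T]linearZ /= sqVu !linearZ /= -scalemxAl scalerA -invfM sqK.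
by rewrite -defC addrC subrK.
Qed.

End Gram.

Section Local.
Variables (R : realType) (n : nat).

Lemma mul_bool_restriction (X : {set 'I_n}) p (B : 'M[R]_(p, #|X|)) j k :
  k \notin X -> (B *m bool_restriction R X) j k = 0.
Proof.
move=> kX; rewrite mxE big1 // => i _; rewrite !mxE.
by case: eqP => [ik|_]; [rewrite -ik enum_valP in kX | rewrite mulr0].
Qed.

(** The product of the transposed restriction with the restriction is the diagonal projector onto
    the coordinates in [X], which fixes every vector supported there. *)
Lemma bool_restrictionK (X : {set 'I_n}) (g : 'rV[R]_n) :
  supp g^T \subset X ->
  g *m (bool_restriction R X)^T *m bool_restriction R X = g.
Proof.
move=> /subsetP gX; apply/rowP => k.
have gE i : (g *m (bool_restriction R X)^T) 0 i = g 0 (enum_val i).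
  rewrite mxE (bigD1 (enum_val i)) //= big1 => [|l /negPf li].
    by rewrite !mxE eqxx mulr1 addr0.
  by rewrite !mxE eq_sym li mulr0.
have [kX|kX] := boolP (k \in X); last first.
  rewrite mul_bool_restriction //; apply/esym/eqP.
  by apply: contraNT kX => gk; apply: gX; rewrite inE mxE.
rewrite mxE (bigD1 (enum_rank_in kX k)) //= big1 => [|i ik].
  by rewrite gE !mxE enum_rankK_in // eqxx mulr1 addr0.
rewrite !mxE; case: eqP => [ki|_]; last by rewrite mulr0.
by have := enum_valK_in kX i; rewrite ki => ki'; rewrite ki' eqxx in ik.
Qed.

Lemma gram_sum_rows m (G : 'M[R]_(m, n)) :
  G^T *m G = \sum_j (row j G)^T *m row j G.
Proof.
apply/matrixP => k l; rewrite mxE summxE; apply: eq_bigr => j _.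
by rewrite !mxE big_ord1 !mxE.
Qed.

Variables (I : finType) (U : I -> {set 'I_n}).

(** Condition (2) as a predicate on the matrix: being closed under 0 and addition, it passes to the
    sum over the cover by induction. *)
Definition local_gram (A : 'M[R]_n) : Prop :=
  exists m (G : 'M[R]_(m, n)), cover_local U G /\ A = G^T *m G.

Lemma local_gram0 : local_gram 0.
Proof. by exists 0%N, 0; split=> [[]//|]; rewrite mulmx0. Qed.

Lemma local_gramD A B : local_gram A -> local_gram B -> local_gram (A + B).
Proof.
move=> [m1 [G1 [loc1 ->]]] [m2 [G2 [loc2 ->]]].
exists (m1 + m2)%N, (col_mx G1 G2); split; last by rewrite tr_col_mx mul_row_col.
by move=> j; rewrite -(splitK j); case: (split j) => i /=;
  rewrite (rowKu, rowKd).
Qed.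

Lemma local_gram_restriction a (B : 'M[R]_#|U a|) :
  sym_possemidef B ->
  local_gram ((bool_restriction R (U a))^T *m B *m bool_restriction R (U a)).
Proof.
move=> /possemidef_gram[m [C ->]].
exists m, (C *m bool_restriction R (U a)); split; last first.
  by rewrite trmx_mul !mulmxA.
move=> j; exists a; apply/subsetP => k; rewrite inE mxE mxE.
by apply: contraR => kU; rewrite mul_bool_restriction.
Qed.

End Local.

Lemma sum_gram_possemidef (R : realType) (n : nat) (J : finType) (P : pred J)
    (g : J -> 'rV[R]_n) : sym_possemidef (\sum_(j | P j) (g j)^T *m g j).
Proof.
split=> [|x].
  apply/symmetricmxP; rewrite linear_sum; apply: eq_bigr => j _ /=.
  by rewrite trmx_mul trmxK.
rewrite mulmx_sumr mulmx_suml summxE; apply: sumr_ge0 => j _.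
by have [_] := gram_possemidef (g j); apply.
Qed.

Theorem theorem3p2 (R : realType) (n : nat) (A : 'M[R]_n)
    (I : finType) (U : I -> {set 'I_n}) :
  sym_posdef A ->
  index_cover U ->
  (exists At : forall a : I, 'M[R]_#|U a|,
      (forall a : I, sym_possemidef (At a)) /\
      A = \sum_(a : I)
            (bool_restriction R (U a))^T *m At a *m bool_restriction R (U a))
  <->
  (exists (m : nat) (G : 'M[R]_(m, n)), cover_local U G /\ A = G^T *m G).
Proof.
move=> _ _; split=> [[At [psdAt ->]]|[m [G [locG ->]]]].
  apply: (big_ind (local_gram U)) => [|B C|a _].
  - exact: local_gram0.
  - exact: local_gramD.
  - exact: local_gram_restriction.
(* A row may be supported in several sets of the cover; [f] commits it to one of them, so that it is
   counted exactly once. *)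
have [f fP] := fin_all_exists locG.
pose g a j := row j G *m (bool_restriction R (U a))^T.
(* The local matrix at [a] collects the restricted rows assigned to [a]; it is 0 when there are
   none. *)
exists (fun a => \sum_(j | f j == a) (g a j)^T *m g a j); split=> [a|].
  exact: sum_gram_possemidef.
rewrite gram_sum_rows (partition_big f xpredT) //=; apply: eq_bigr => a _.
rewrite mulmx_sumr mulmx_suml; apply: eq_bigr => j /eqP fj.
by rewrite mulmxA -trmx_mul -mulmxA bool_restrictionK // -fj.
Qed.
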